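(* Let $p\ge 2$, $\alpha\ge 1$, $\beta\ge 1$ be integers. All DAV forms with parameters $p,\alpha,\beta$ have pairwise distinct rows if and only if one of the following conditions holds: (i) $p=2$, $\beta\geq \alpha-1$, and $\alpha+\beta$ is odd; (ii) $p=3$, and $\beta\geq 2\alpha$ or $\beta=2\alpha-2$; (iii) $p\geq 4$, $(\alpha,\beta)\neq(1,1)$, and $\beta\geq 2\alpha-2$.
   Context: There are two voters. $A$ is a set of $p$ candidates; the first voter has $\alpha$ voting cards and the second has $\beta$ voting cards. The sets of voting strategies are $X=\{x\in\mathbb{Z}_{\ge 0}^A : \sum_{a\in A}x_a=\alpha\}$ and $Y=\{y\in\mathbb{Z}_{\ge 0}^A : \sum_{a\in A}y_a=\beta\}$, with $k=|X|=\binom{\alpha+p-1}{p-1}$ and $\ell=|Y|=\binom{\beta+p-1}{p-1}$. For $z\in\mathbb{Z}^A$ let $AM(z)=\{a\in A : z_a=\max_{c\in A}z_c\}$. A matrix $g\in A^{k\times\ell}$ is a distributed approval voting form (DAV form) with parameters $p,\alpha,\beta$ if the strategies can be labeled bijectively as $X=\{x^1,\dots,x^k\}$, $Y=\{y^1,\dots,y^\ell\}$ such that $g(i,j)\in AM(x^i+y^j)$ for all $i=1,\dots,k$, $j=1,\dots,\ell$. *)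

(* Defs.v *)
From HB Require Import structures.
From mathcomp Require Import all_boot all_order all_algebra.
Set Implicit Arguments.
Unset Strict Implicit.
Unset Printing Implicit Defensive.
Import Order.TTheory GRing.Theory Num.Theory.
Local Open Scope nat_scope.

Definition strategy (A : finType) (n : nat) : Type :=
  {x : {ffun A -> nat} | \sum_(a : A) x a == n}.

Definition nb_strategies (p n : nat) : nat := 'C(n + p - 1, p - 1).

(* Taking z a itself as the unit of the big operator makes the right-hand side
   the maximum of all the coordinates of z. *)
Definition AM (A : finType) (z : {ffun A -> int}) : {set A} :=
  [set a | z a == \big[Order.max/z a]_(c : A) z c].

Definition profile_sum (A : finType) (alpha beta : nat)
    (x : strategy A alpha) (y : strategy A beta) : {ffun A -> int} :=
  [ffun a => ((val x a)%:Z + (val y a)%:Z)%R].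

Definition DAV_form (p alpha beta : nat) (A : finType)
    (g : 'M[A]_(nb_strategies p alpha, nb_strategies p beta)) : Prop :=
  exists (x : 'I_(nb_strategies p alpha) -> strategy A alpha)
         (y : 'I_(nb_strategies p beta) -> strategy A beta),
    [/\ bijective x, bijective y
      & forall i j, g i j \in AM (profile_sum (x i) (y j))].
Arguments DAV_form p alpha beta {A} g.

Definition distinct_rows (T : Type) (k l : nat) (g : 'M[T]_(k, l)) : Prop :=
  injective (fun i : 'I_k => row i g).

Lemma in_AM (A : finType) (z : {ffun A -> int}) (a : A) :
  reflect (forall c, (z c <= z a)%R) (a \in AM z).
Proof.
rewrite inE; apply: (iffP eqP) => [-> c | h]; first exact: le_bigmax.
by apply/le_anti; rewrite bigmax_ge_id /=; apply/bigmax_leP; split=> [//|c _]; exact: h.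
Qed.

(* nb_strategies counts the strategies, so labellings as in DAV_form exist. *)
Lemma strategy_labelling (A : finType) (p n : nat) : #|A| = p -> 0 < p ->
  exists x : 'I_(nb_strategies p n) -> strategy A n, bijective x.
Proof.
case: p => // m hA _.
have -> : nb_strategies m.+1 n = #|[set t : m.+1.-tuple 'I_n.+1 | \sum_(i <- t) i == n]|.
  by rewrite card_ord_partitions /nb_strategies addnS !subn1 /= addnC.
set S := [set t : _ | _].
pose r (a : A) : 'I_m.+1 := cast_ord hA (enum_rank a).
pose r' (i : 'I_m.+1) : A := enum_val (cast_ord (esym hA) i).
have rK : cancel r r' by move=> a; rewrite /r /r' cast_ordK enum_rankK.
have r'K : cancel r' r by move=> i; rewrite /r /r' enum_valK cast_ordKV.
have sumr (F : 'I_m.+1 -> nat) : \sum_a F (r a) = \sum_i F i.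
  by rewrite (reindex r) //; exists r' => a _; rewrite ?rK ?r'K.
have hf (i : 'I_#|S|) : \sum_a [ffun a => val (tnth (enum_val i) (r a))] a == n.
  under eq_bigr do rewrite ffunE.
  rewrite (sumr (fun j => val (tnth (enum_val i) j))).
  by have := enum_valP i; rewrite inE big_tuple.
pose f (i : 'I_#|S|) : strategy A n :=
  exist (fun x : {ffun A -> nat} => \sum_a x a == n) _ (hf i).
have le_n (s : strategy A n) a : val s a <= n.
  by case: s => s /= /eqP <-; rewrite (bigD1 a) //= leq_addr.
have hg (s : strategy A n) : [tuple inord (val s (r' i)) | i < m.+1] \in S.
  rewrite inE big_tuple; under eq_bigr => i _.
    rewrite tnth_mktuple inordK; first over.
    by rewrite ltnS le_n.
  by rewrite -(sumr (fun i => val s (r' i))); under eq_bigr do rewrite rK; exact: valP s.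
exists f, (fun s => enum_rank_in (hg s) [tuple inord (val s (r' i)) | i < m.+1]).
  move=> i; apply: enum_val_inj; rewrite enum_rankK_in ?hg //.
  by apply: eq_from_tnth => j; rewrite tnth_mktuple ffunE r'K inord_val.
move=> s; apply: val_inj; apply/ffunP => a; rewrite /= ffunE enum_rankK_in ?hg //.
rewrite tnth_mktuple rK inordK // ltnS; exact: le_n.
Qed.

(* Main.v *)
(** All DAV forms have distinct rows iff any two strategies [x <> x'] of the
    first voter are separated by some [y]: [AM (x + y)] and [AM (x' + y)] are
    disjoint.

    Sufficiency: pick [a], [b] with [x' a < x a] and [x b < x' b] and put almost
    all cards of [y] on [a] and [b], so that [a] beats [b] in [x + y] and loses
    to [b] in [x' + y].  If [x a - x b] and [x' a - x' b] differ by 2 only, this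
    needs [y a + y b] and [x a + x b] to have opposite parities, and one card may
    have to go to a third candidate.

    Necessity: if [y] separates [z + e_a] from [z + e_b], then [a] and [b] are
    tied for the maximum in [z + y]; a suitable [z], concentrated on one
    candidate, makes this impossible. *)
Require Import Defs.
From mathcomp Require Import all_boot all_order all_algebra.
From mathcomp Require Import zify.
Set Implicit Arguments.
Unset Strict Implicit.
Unset Printing Implicit Defensive.
Local Open Scope nat_scope.

(** * Vote counts and the separation criterion *)

Section Strategies.
Variable A : finType.
Implicit Types a b c d : A.

Definition votes n (x : strategy A n) a : nat := val x a.
Arguments votes : simpl never.

Definition separates alpha beta (y : strategy A beta) (x x' : strategy A alpha) :=
  [disjoint AM (profile_sum x y) & AM (profile_sum x' y)].

Lemma in_AM_profile alpha beta (x : strategy A alpha) (y : strategy A beta) a :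
  reflect (forall c, votes x c + votes y c <= votes x a + votes y a)
          (a \in AM (profile_sum x y)).
Proof.
apply: (iffP (in_AM _ _)) => h c; have := h c.
  by rewrite !ffunE -!PoszD lez_nat.
by rewrite !ffunE -!PoszD lez_nat.
Qed.

Lemma sum_strategy n (x : strategy A n) : \sum_a votes x a = n.
Proof. exact/eqP/(valP x). Qed.

Lemma strategy_of_fun n (f : A -> nat) :
  \sum_a f a = n -> exists x : strategy A n, forall a, votes x a = f a.
Proof.
move=> hf; have hx : \sum_a [ffun a => f a] a == n.
  by rewrite -hf; apply/eqP/eq_bigr => a _; rewrite ffunE.
exists (exist (fun x : {ffun A -> nat} => \sum_a x a == n) _ hx) => a.
by rewrite /votes /= ffunE.
Qed.

Lemma sum_pred1 a n : \sum_d (d == a) * n = n.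
Proof.
rewrite (bigD1 a) //= eqxx mul1n big1 ?addn0 // => d /negPf-> //.
Qed.

Lemma sumD2 (f : A -> nat) a b : a != b ->
  \sum_d f d = f a + f b + \sum_(d | (d != a) && (d != b)) f d.
Proof. by move=> ab; rewrite (bigD1 a) //= (bigD1 b) 1?eq_sym //= addnA. Qed.

Lemma sumD3 (f : A -> nat) a b c : a != b -> c != a -> c != b ->
  \sum_d f d =
    f a + f b + f c + \sum_(d | (d != a) && (d != b) && (d != c)) f d.
Proof. by move=> ab ca cb; rewrite (sumD2 _ ab) (bigD1 c) ?ca //= addnA. Qed.

Lemma sum_outside_eq0 (f : A -> nat) (B : {set A}) (P : pred A) :
  #|B| = #|A| -> (forall d, P d -> d \notin B) -> \sum_(d | P d) f d = 0.
Proof.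
move=> hB hP; rewrite big1 // => d /hP; suff -> : B = setT by rewrite inE.
by apply/eqP; rewrite eqEcard subsetT cardsT hB leqnn.
Qed.

(** Both totals are [n], so [x <= x'] in every coordinate would force equality. *)
Lemma exists_strategy_lt n (x x' : strategy A n) :
  x <> x' -> exists a, votes x' a < votes x a.
Proof.
move=> neq; apply/existsP; apply: contra_notT neq => /existsPn h.
have le d : votes x d <= votes x' d by rewrite leqNgt h.
apply/val_inj/ffunP => d; rewrite -!/(votes _ d); apply/eqP; rewrite eqn_leq le leqNgt.
apply/negP => lt; have := etrans (sum_strategy x) (esym (sum_strategy x')).
rewrite (bigD1 d) //= [in RHS](bigD1 d) //= => e.
have : \sum_(c | c != d) votes x c <= \sum_(c | c != d) votes x' c by exact: leq_sum.
lia.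
Qed.

Lemma separatesPn alpha beta (y : strategy A beta) (x x' : strategy A alpha) :
  ~~ separates y x x' ->
  exists a, a \in AM (profile_sum x y) :&: AM (profile_sum x' y).
Proof. by rewrite /separates -setI_eq0 => /set0Pn. Qed.

(** If no [y] separates [x] and [x'], every column has a common winner for both; entering it in both
    rows gives a DAV form with two equal rows. Conversely, a separating column makes the two rows
    differ in every DAV form. *)
Lemma distinct_rowsP (p alpha beta : nat) : #|A| = p -> 0 < p ->
  (forall g : 'M[A]_(nb_strategies p alpha, nb_strategies p beta),
      DAV_form p alpha beta g -> distinct_rows g)
  <->
  (forall x x' : strategy A alpha, x <> x' ->
     exists y : strategy A beta, separates y x x').
Proof.
move=> hA hp; split=> [h x x' neq | h g [x [y [bx by_ hg]]] i i' /rowP eqg].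
- have [lx bx] := strategy_labelling alpha hA hp.
  have [ly by_] := strategy_labelling beta hA hp.
  have [[fx fxK xfK] [fy fyK yfK]] := (bx, by_).
  suff /existsP[j sep] : [exists j, separates (ly j) x x'] by exists (ly j).
  apply: contra_notT neq => /existsPn nsep.
  have AMn0 i j : exists a, a \in AM (profile_sum (lx i) (ly j)).
    have /card_gt0P[a0 _] : 0 < #|A| by rewrite hA.
    exists [arg max_(a > a0) (votes (lx i) a + votes (ly j) a)].
    by apply/in_AM_profile => c; case: arg_maxnP => // a _; exact.
  pose g := (\matrix_(i, j)
    if (lx i == x) || (lx i == x') then xchoose (separatesPn (nsep j))
    else xchoose (AMn0 i j))%R.
  have /h injg : DAV_form p alpha beta g.
    exists lx, ly; split=> // i j; rewrite mxE.
    case: ifP => [/orP | _]; last exact: xchooseP.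
    have := xchooseP (separatesPn (nsep j)).
    by rewrite inE => /andP[? ?] [] /eqP->.
  rewrite -(xfK x) -(xfK x'); congr lx; apply: injg.
  by apply/rowP => j; rewrite !mxE ifT ?xfK ?eqxx // ifT ?xfK ?eqxx ?orbT.
- apply: (bij_inj bx); apply/eqP/negPn/negP => /eqP /h [s].
  have [fy _ yfK] := by_; rewrite -(yfK s) /separates disjoint_subset.
  move/subsetP/(_ _ (hg i (fy s))); rewrite inE.
  by have := eqg (fy s); rewrite !mxE => ->; rewrite hg.
Qed.

(** * Ties forced by separation *)

Lemma separating_tie alpha beta (x x' : strategy A alpha) (y : strategy A beta)
    (z : A -> nat) a b : a != b ->
  (forall d, votes x d = z d + (d == a)) ->
  (forall d, votes x' d = z d + (d == b)) ->
  separates y x x' ->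
  z a + votes y a = z b + votes y b
  /\ forall d, z d + votes y d <= z a + votes y a.
Proof.
move=> ab hx hx' sep.
have common d : (forall c, votes x c + votes y c <= votes x d + votes y d) ->
    ~ (forall c, votes x' c + votes y c <= votes x' d + votes y d).
  move=> /in_AM_profile h1 /in_AM_profile h2.
  by move: (disjointFr sep h1); rewrite h2.
pose w c := z c + votes y c.
case: (@arg_maxnP _ a predT w) => // m _ hm.
have {}hm c : z c + votes y c <= z m + votes y m by exact: hm.
have [ha hb] := (hm a, hm b).
(* A candidate strictly ahead of both [a] and [b] still wins after either gains one vote, so it
   would be a common winner. *)
have [lt | ge] :=
    ltnP (maxn (z a + votes y a) (z b + votes y b)) (z m + votes y m).
  by case: (common m) => c; have := hm c; rewrite ?hx ?hx';
    [have [->|_] := eqVneq c a | have [->|_] := eqVneq c b]; lia.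
have ba : b != a by rewrite eq_sym.
have [eq | neq] := eqVneq (z a + votes y a) (z b + votes y b).
  by split=> // d; have := hm d; lia.
(* If [b] leads [a], the extra vote lets [a] at most catch up, so [b] wins in both sums; the
   remaining case is symmetric. *)
have [lt | ge2] := ltnP (z a + votes y a) (z b + votes y b).
  by case: (common b) => c; have := hm c; rewrite ?hx ?hx' ?eqxx ?(negPf ba);
    [have [->|_] := eqVneq c a | have [->|_] := eqVneq c b]; lia.
by case: (common a) => c; have := hm c; rewrite ?hx ?hx' ?eqxx ?(negPf ab);
  [have [->|_] := eqVneq c a | have [->|_] := eqVneq c b]; lia.
Qed.

(* [z] is [(alpha - 1) e_c], and [c] may coincide with [a] or [b]. *)
Lemma tie_of_separation alpha beta a b c : a != b -> 0 < alpha ->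
  (forall x x' : strategy A alpha, x <> x' ->
     exists y : strategy A beta, separates y x x') ->
  exists y : strategy A beta,
    (a == c) * alpha.-1 + votes y a = (b == c) * alpha.-1 + votes y b
    /\ forall d, (d == c) * alpha.-1 + votes y d <= (a == c) * alpha.-1 + votes y a.
Proof.
move=> ab al0 h; pose z d := (d == c) * alpha.-1.
have sumz e : \sum_d (z d + (d == e)) = alpha.
  under eq_bigr do rewrite -[X in _ + X]muln1.
  by rewrite big_split /= !sum_pred1 addn1 prednK.
have [x hx] := strategy_of_fun (sumz a).
have [x' hx'] := strategy_of_fun (sumz b).
have neq : x <> x'.
  move=> e; have := hx a; rewrite e hx' eqxx (negPf ab); lia.
have [y sep] := h _ _ neq; exists y.
exact: (separating_tie ab hx hx' sep).
Qed.

(** * Construction of separating strategies *)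

Lemma separates_of_lead alpha beta (x x' : strategy A alpha)
    (y : strategy A beta) a b :
  votes x' a + votes y a < votes x' b + votes y b ->
  (forall d, d != a -> votes x d + votes y d < votes x a + votes y a) ->
  separates y x x'.
Proof.
(* The only winner for [x] is [a], and [b] beats [a] for [x']. *)
move=> ltb lta; rewrite /separates disjoint_subset; apply/subsetP => d.
move=> /in_AM_profile hd; rewrite inE.
have [-> | /lta] := eqVneq d a; last by have := hd a; lia.
by apply/negP => /in_AM_profile/(_ b); lia.
Qed.

(* The separating [y] puts [na] cards on [a], [nb] on [b] and [e] on [c]. *)
Lemma separates_three alpha beta (x x' : strategy A alpha) a b c na nb e :
  a != b -> c != a -> c != b -> na + nb + e = beta ->
  votes x b + nb < votes x a + na ->
  votes x' a + na < votes x' b + nb ->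
  (forall d, d != a -> d != b -> votes x d + (d == c) * e < votes x a + na) ->
  exists y : strategy A beta, separates y x x'.
Proof.
move=> ab ca cb sumy lta ltb ltd.
have [|y hy] :=
    @strategy_of_fun beta (fun d => (d == a) * na + (d == b) * nb + (d == c) * e).
  by rewrite !big_split /= !sum_pred1.
exists y; apply: (@separates_of_lead _ _ _ _ _ a b) => [|d da]; rewrite !hy.
  rewrite !eqxx (negPf ab) ![_ == c]eq_sym (negPf ca) (negPf cb).
  by rewrite [b == a]eq_sym (negPf ab); lia.
rewrite !eqxx (negPf da) (negPf ab) [a == c]eq_sym (negPf ca).
have [->|db] := eqVneq d b; first by rewrite [b == c]eq_sym (negPf cb); lia.
by have := ltd d da db; lia.
Qed.

(** Stated without a third candidate, so that it also covers [p = 2]. *)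
Lemma separates_two alpha beta (x x' : strategy A alpha) a b na nb :
  a != b -> na + nb = beta ->
  votes x b + nb < votes x a + na ->
  votes x' a + na < votes x' b + nb ->
  (forall d, d != a -> d != b -> votes x d < votes x a + na) ->
  exists y : strategy A beta, separates y x x'.
Proof.
move=> ab sumy lta ltb ltd.
have [|y hy] :=
    @strategy_of_fun beta (fun d => (d == a) * na + (d == b) * nb).
  by rewrite !big_split /= !sum_pred1.
exists y; apply: (@separates_of_lead _ _ _ _ _ a b) => [|d da]; rewrite !hy.
  by rewrite !eqxx (negPf ab) [b == a]eq_sym (negPf ab); lia.
rewrite !eqxx (negPf da) (negPf ab).
have [->|db] := eqVneq d b; first by lia.
by have := ltd d da db; lia.
Qed.

End Strategies.

(** The difference [nb - na] must lie strictly between [xa' - xb'] and [xa - xb] and have the parity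
    of [n]. If these bounds are at least 3 apart, both parities occur between them; if they are 2
    apart, the single value [xa - xb - 1] must have the parity of [n]. *)
Lemma split_cards alpha n xa xb xa' xb' :
  xa' < xa -> xb < xb' -> xa + xb <= alpha -> xa' + xb' <= alpha ->
  alpha <= n.+1 ->
  (xa + xb' >= xb + xa' + 3) || odd (n + xa + xb) ->
  exists na nb, [/\ na + nb = n, xb + nb < xa + na & xa' + na < xb' + nb].
Proof.
move=> lta ltb sx sx' ltn par.
(* This is the least [na] putting [a] ahead of [b] for [x]; the subtraction does not truncate, as
   [xa <= alpha <= n + 1]. *)
exists (n + 2 + xb - xa)./2, (n - (n + 2 + xb - xa)./2).
by split; lia.
Qed.

(** * The cases of two, three and more candidates *)

Section Characterization.
Variable A : finType.

Lemma necessity p alpha beta : #|A| = p -> 2 <= p -> 1 <= alpha -> 1 <= beta ->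
  (forall x x' : strategy A alpha, x <> x' ->
     exists y : strategy A beta, separates y x x') ->
  [\/ [/\ p = 2, beta >= alpha - 1 & odd (alpha + beta)],
      p = 3 /\ (beta >= 2 * alpha \/ beta = 2 * alpha - 2)
    | [/\ p >= 4, (alpha, beta) <> (1, 1) & beta >= 2 * alpha - 2]].
Proof.
move=> hA hp al0 be0 sep.
have [p2 | p3] := eqVneq p 2.
  have /card_gt1P[a [b [_ _ ab]]] : 1 < #|[set: A]| by rewrite cardsT hA.
  (* With [c = a] the tie reads [alpha - 1 + votes y a = votes y b], so
     [beta = alpha - 1 + 2 * votes y a]. *)
  have [y [tie _]] := tie_of_separation a ab al0 sep.
  move: tie (sum_strategy y); rewrite (sumD2 _ ab) eqxx [b == a]eq_sym (negPf ab).
  rewrite (@sum_outside_eq0 _ _ [set a; b]) ?cards2 ?ab ?hA // => [tie s|d].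
    by constructor 1; split=> //; lia.
  by rewrite !inE negb_or.
have /card_gt2P[a [b [c [_ [ab bc ca]]]]] : 2 < #|[set: A]|.
  by rewrite cardsT hA; lia.
have cb : c != b by rewrite eq_sym.
(* Now [votes y a = votes y b >= alpha - 1 + votes y c], whence [beta >= 2 * alpha - 2]. *)
have [y [tie le]] := tie_of_separation c ab al0 sep.
have := sum_strategy y; rewrite (sumD3 _ ab ca cb) => s.
have := le c; move: tie; rewrite eqxx ![_ == c]eq_sym (negPf ca) (negPf cb) => tie lec.
have [p3' | p4] := eqVneq p 3.
  constructor 2; split=> //; move: s.
  (* Here [beta = 2 * votes y a + votes y c]. If [beta = 2 * alpha - 1], then [votes y c] is odd,
     hence positive, and [beta >= 2 * alpha + 1], a contradiction. *)
  rewrite (@sum_outside_eq0 _ _ [set a; b; c]) => [s||d]; first by lia.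
    by rewrite hA p3' setUC cardsU1 cards2 ab !inE negb_or ca cb.
  by rewrite !inE !negb_or.
constructor 3; split; [lia | | lia].
(* A single card cannot be shared by the tied [a] and [b], so both get none, and their count bounds
   all others. *)
case=> e1 e2; suff : \sum_d votes y d = 0 by rewrite sum_strategy e2.
by rewrite big1 // => d _; have := le d; rewrite [a == c]eq_sym (negPf ca); lia.
Qed.

Lemma sufficiency p alpha beta : #|A| = p -> 1 <= alpha -> 1 <= beta ->
  [\/ [/\ p = 2, beta >= alpha - 1 & odd (alpha + beta)],
      p = 3 /\ (beta >= 2 * alpha \/ beta = 2 * alpha - 2)
    | [/\ p >= 4, (alpha, beta) <> (1, 1) & beta >= 2 * alpha - 2]] ->
  forall x x' : strategy A alpha, x <> x' ->
     exists y : strategy A beta, separates y x x'.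
Proof.
move=> hA al0 be0 cond x x' neq.
have [a lta] := exists_strategy_lt neq.
have [b ltb] := exists_strategy_lt (nesym neq).
have ab : a != b by apply: contraTneq lta => ->; lia.
have [sx sx'] := (sum_strategy x, sum_strategy x').
have := sx; have := sx'; rewrite !(sumD2 _ ab) => sx'2 sx2.
have third d : d != a -> d != b -> votes x a + votes x b + votes x d <= alpha.
  by move=> da db; rewrite -[leqRHS]sx (sumD3 _ ab da db) leq_addr.
have [p2 | p2] := eqVneq p 2.
  have all_ab d : (d != a) && (d != b) -> d \notin [set a; b].
    by rewrite !inE negb_or.
  have cab : #|[set a; b]| = #|A| by rewrite cards2 ab hA.
  have rest0 (f : A -> nat) := sum_outside_eq0 f cab all_ab.
  rewrite !rest0 in sx2 sx'2.
  (* Since [x] puts all its cards on [a] and [b], the parity required by [split_cards] is that of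
     [alpha + beta]. *)
  have [||||na [nb [sn lt1 lt2]]] := @split_cards alpha beta _ _ _ _ lta ltb;
    [case: cond => [[]|[]|[]]; lia..|].
  apply: (separates_two ab sn lt1 lt2) => d da db.
  move: (all_ab d); rewrite da db => /(_ isT).
  suff -> : [set a; b] = setT by rewrite inE.
  by apply/eqP; rewrite eqEcard subsetT cardsT cab leqnn.
(* For [p >= 3] the delicate value is [beta = 2 * alpha - 1]. *)
have {}cond : 2 < p /\ 2 * alpha - 2 <= beta /\
    (beta = 2 * alpha - 1 -> 3 < p /\ 1 < alpha).
  case: cond => [[]|[]|[p4 n11 le]]; try lia; split; [lia | split=> // e].
  split=> //; rewrite ltn_neqAle al0 andbT; apply/eqP => e1.
  by case: n11; rewrite e -e1.
case: cond => p3 [hbeta hodd].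
have [par | npar] := boolP ((votes x a + votes x' b >= votes x b + votes x' a + 3)
    || odd (beta + votes x a + votes x b)).
  have [|||na [nb [sn lt1 lt2]]] :=
    @split_cards alpha beta _ _ _ _ lta ltb _ _ _ par; try lia.
  by apply: (separates_two ab sn lt1 lt2) => d da db; have := third d da db; lia.
(* Holding one card back corrects the parity; it goes to a candidate [c] that must stay behind
   [a]. *)
have [||||na [nb [sn lt1 lt2]]] :=
  @split_cards alpha beta.-1 _ _ _ _ lta ltb; try lia.
have sn' : na + nb + 1 = beta by lia.
have outside : #|~: [set a; b]| = p - 2.
  by rewrite cardsCs setCK cards2 ab hA.
suff [c [ca cb hc]] : exists c, [/\ c != a, c != b & votes x c + 1 < votes x a + na].
  apply: (separates_three ab ca cb sn' lt1 lt2) => d da db.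
  by case: (eqVneq d c) => [->|_]; [lia | have := third d da db; lia].
(* In this case [c] could hold [alpha - 1] votes of [x] and then tie with [a]; the weaker of two
   further candidates avoids this. *)
have [e | ne] := eqVneq beta (2 * alpha - 1).
  have [p4 al1] := hodd e.
  have /card_gt1P[c [d []]] : 1 < #|~: [set a; b]| by rewrite outside; lia.
  rewrite !inE !negb_or => /andP[ca cb] /andP[da db] cd.
  have scd : votes x a + votes x b + votes x c + votes x d <= alpha.
    rewrite -[leqRHS]sx (sumD3 _ ab ca cb) leq_add2l (bigD1 d) ?leq_addr //.
    by rewrite da db eq_sym cd.
  have [le | gt] := leqP (votes x c) (votes x d); [exists c | exists d]; split=> //; lia.
(* Any third candidate works: [beta + votes x a + votes x b] is even, so [beta = 2 * alpha - 2]
   gives [votes x a + votes x b >= 2], and otherwise [beta >= 2 * alpha]. *)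
have /card_gt0P[c] : 0 < #|~: [set a; b]| by rewrite outside; lia.
rewrite !inE negb_or => /andP[ca cb]; exists c; split=> //.
have := third c ca cb; lia.
Qed.

End Characterization.

Theorem theorem6 (p alpha beta : nat) (A : finType) (hA : #|A| = p)
    (hp : (2 <= p)%N) (halpha : (1 <= alpha)%N) (hbeta : (1 <= beta)%N) :
  (forall g : 'M[A]_(nb_strategies p alpha, nb_strategies p beta),
      DAV_form p alpha beta g -> distinct_rows g)
  <->
  [\/ [/\ p = 2, (beta >= alpha - 1)%N & odd (alpha + beta)],
      p = 3 /\ ((beta >= 2 * alpha)%N \/ beta = (2 * alpha - 2)%N)
    | [/\ (p >= 4)%N, (alpha, beta) <> (1%N, 1%N) & (beta >= 2 * alpha - 2)%N]].
Proof.
rewrite distinct_rowsP //; last exact: ltnW.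
by split=> [/necessity | /sufficiency]; apply.
Qed.
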